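(* Let $A$ be a set of actions containing $\tau$ and $(S,\to)$ a labelled transition system with labels from $A$. Then $\simeq_{D_4}\;\subseteq\;\simeq_{D_3}$ (relations defined in the context).
   Context: $s\xrightarrow{a}s'$ means $(s,a,s')\in\to$; $s\xrightarrow{(a)}s'$ means ''$s\xrightarrow{a}s'$, or ($a=\tau$ and $s=s'$)''; $\twoheadrightarrow$ and $\to^+$ are the reflexive–transitive and transitive closures of $\xrightarrow{\tau}$; $\omega=\{0,1,\dots\}$. For a binary relation $R$ on $S$: (T) if $sRt$ and $s\xrightarrow{a}s'$, then there are $t'',t'$ with $t\twoheadrightarrow t''\xrightarrow{(a)}t'$, $sRt''$ and $s'Rt'$. (D$_3$) if $sRt$ and $(s_k)_{k\in\omega}$ is infinite with $s=s_0$ and $s_k\xrightarrow{\tau}s_{k+1}$ for all $k$, then there are an infinite $(t_\ell)_{\ell\in\omega}$ and $\sigma:\omega\to\omega$ with $t=t_0$, $t_\ell\xrightarrow{\tau}t_{\ell+1}$ and $s_{\sigma(\ell)}Rt_\ell$ for all $\ell$. (D$_4$) if $sRt$ and $(s_k)_{k\in\omega}$ is infinite with $s=s_0$, $s_k\xrightarrow{\tau}s_{k+1}$ and $s_kRt$ for all $k$, then there is $t'$ with $t\to^+t'$ and $s_kRt'$ for some $k$. $s\simeq_{D_3}t$ iff some symmetric $R$ satisfying (T) and (D$_3$) has $sRt$; $s\simeq_{D_4}t$ iff some symmetric $R$ satisfying (T) and (D$_4$) has $sRt$. *)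

(* Defs.v *)
From Stdlib Require Import Relations.

Section BranchingBisimilarity.

Context {A State : Type} (tau : A) (step : State -> A -> State -> Prop).

Definition tau_step : relation State := fun s s' => step s tau s'.

Definition opt_step (s : State) (a : A) (s' : State) : Prop :=
  step s a s' \/ (a = tau /\ s = s').

Definition tau_star : relation State := clos_refl_trans State tau_step.

Definition tau_plus : relation State := clos_trans State tau_step.

Definition cond_T (R : relation State) : Prop :=
  forall s t a s', R s t -> step s a s' ->
    exists t'' t', tau_star t t'' /\ opt_step t'' a t' /\ R s t'' /\ R s' t'.

Definition cond_D3 (R : relation State) : Prop :=
  forall s t (u : nat -> State),
    R s t -> s = u 0 -> (forall k, tau_step (u k) (u (S k))) ->
    exists (v : nat -> State) (sigma : nat -> nat),
      t = v 0 /\ forall l, tau_step (v l) (v (S l)) /\ R (u (sigma l)) (v l).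

Definition cond_D4 (R : relation State) : Prop :=
  forall s t (u : nat -> State),
    R s t -> s = u 0 -> (forall k, tau_step (u k) (u (S k)) /\ R (u k) t) ->
    exists t', tau_plus t t' /\ exists k, R (u k) t'.

Definition simeq_D3 : relation State := fun s t =>
  exists R : relation State, symmetric State R /\ cond_T R /\ cond_D3 R /\ R s t.

Definition simeq_D4 : relation State := fun s t =>
  exists R : relation State, symmetric State R /\ cond_T R /\ cond_D4 R /\ R s t.

End BranchingBisimilarity.

(* Main.v *)
Require Import Defs.
From Stdlib Require Import Relations Operators_Properties.
From Stdlib Require Import Classical ClassicalEpsilon.

(** Given a symmetric [R] satisfying (T) and (D4), its stuttering closure
    satisfies (T) and (D3).  Along a divergence [u], a state [x] related by the
    closure to some [u k] always has a tau-successor with the same property: it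
    reaches silently some [n] with [R (u k) n], and every state on the way is
    related to [u k].  If [x] is itself [n], then either [R (u j) x] holds for
    all [j >= k], and (D4) makes [x] move, or [R (u j) x] holds and
    [R (u (S j)) x] fails for some [j], and (T) makes [x] move.  Iterating this
    successor gives the matching divergence. *)

Lemma exists_infinite_path {X : Type} (E : relation X) (P : X -> Prop) :
  (forall x, P x -> exists y, E x y /\ P y) ->
  forall x, P x ->
    exists v : nat -> X, v 0 = x /\ forall l, E (v l) (v (S l)) /\ P (v l).
Proof.
  intros next x Px.
  (* Dependent choice: the iteration runs on the subtype [{y | P y}], so that each chosen point
     carries the proof required for choosing the next one. *)
  set (next_sig := fun p : {y | P y} =>
    constructive_indefinite_description _ (next (proj1_sig p) (proj2_sig p))).
  set (succ := fun p => exist P (proj1_sig (next_sig p))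
                          (proj2 (proj2_sig (next_sig p)))).
  set (w := fix w (l : nat) : {y | P y} :=
    match l with 0 => exist P x Px | S l => succ (w l) end).
  exists (fun l => proj1_sig (w l)); split; [reflexivity|].
  intro l; split.
  - exact (proj1 (proj2_sig (next_sig (w l)))).
  - exact (proj2_sig (w l)).
Qed.

Section StutteringClosure.

Context {A State : Type} (tau : A) (step : State -> A -> State -> Prop).

Notation tau_step := (tau_step tau step).
Notation tau_star := (tau_star tau step).
Notation tau_plus := (tau_plus tau step).

Lemma tau_plus_head x y :
  tau_plus x y -> exists x1, tau_step x x1 /\ tau_star x1 y.
Proof.
  intro H; apply clos_trans_t1n in H; destruct H as [y H|x1 y H H'].
  - exists y; split; [exact H|apply rt_refl].
  - exists x1; split; [exact H|].
    apply clos_t1n_trans, clos_t_clos_rt in H'; exact H'.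
Qed.

Lemma tau_star_head x y :
  tau_star x y -> x = y \/ exists x1, tau_step x x1 /\ tau_star x1 y.
Proof.
  intro H; apply clos_rt_rt1n in H; destruct H as [|x1 y H H'].
  - left; reflexivity.
  - right; exists x1; split; [exact H|apply clos_rt1n_rt; exact H'].
Qed.

Lemma cond_T_tau_star R : cond_T tau step R ->
  forall s s', tau_star s s' ->
  forall t, R s t -> exists t', tau_star t t' /\ R s' t'.
Proof.
  intros HT s s' Hs; apply clos_rt_rt1n in Hs.
  induction Hs as [s|s s1 s' Hstep _ IH]; intros t Rst.
  - exists t; split; [apply rt_refl|exact Rst].
  - destruct (HT s t tau s1 Rst Hstep) as (t'' & t1 & Htt'' & Hopt & _ & R1).
    destruct (IH t1 R1) as (t' & Ht' & R').
    exists t'; split; [|exact R'].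
    apply rt_trans with t''; [exact Htt''|].
    destruct Hopt as [Hopt|[_ ->]]; [|exact Ht'].
    apply rt_trans with t1; [apply rt_step; exact Hopt|exact Ht'].
Qed.

(** The pairs are crossed: the earlier end on each side is related to the later end on the other.
    Exchanging the sides swaps the two pairs, so symmetry is inherited from [R]. *)
Definition stuttering_closure (R : relation State) : relation State :=
  fun s t => exists s0 s1 t0 t1,
    tau_star s0 s /\ tau_star s s1 /\ tau_star t0 t /\ tau_star t t1 /\
    R s0 t1 /\ R s1 t0.

Lemma stuttering_closure_incl R : inclusion State R (stuttering_closure R).
Proof.
  intros s t Rst; exists s, s, t, t; repeat split; try apply rt_refl; exact Rst.
Qed.

Lemma stuttering_closure_sym R :
  symmetric State R -> symmetric State (stuttering_closure R).
Proof.
  intros Rsym s t (s0 & s1 & t0 & t1 & H1 & H2 & H3 & H4 & R1 & R2).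
  exists t0, t1, s0, s1; repeat split; try assumption; apply Rsym; assumption.
Qed.

(** The lower end [t0] and its partner [s1] are kept, while [R s n] supplies the other crossed pair,
    with [s] as its own lower end. *)
Lemma stuttering_closure_between R s t x n :
  stuttering_closure R s t -> tau_star t x -> tau_star x n -> R s n ->
  stuttering_closure R s x.
Proof.
  intros (s0 & s1 & t0 & t1 & _ & H2 & H3 & _ & _ & R2) Htx Hxn Rsn.
  exists s, s1, t0, n; repeat split; try assumption; [apply rt_refl|].
  apply rt_trans with t; assumption.
Qed.

(** From [R s0 t1], the silent path from [s0] to [s] is matched by one starting at [t1], which [t]
    reaches silently. *)
Lemma stuttering_closure_reach R : cond_T tau step R ->
  forall s t, stuttering_closure R s t -> exists n, tau_star t n /\ R s n.
Proof.
  intros HT s t (s0 & s1 & t0 & t1 & H1 & _ & _ & H4 & R1 & _).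
  destruct (cond_T_tau_star R HT s0 s H1 t1 R1) as (n & Hn & Rsn).
  exists n; split; [apply rt_trans with t1; assumption|exact Rsn].
Qed.

(** Moving silently from [t] to some [n] with [R s n] reduces the claim to (T) for [R]. *)
Lemma stuttering_closure_T R :
  cond_T tau step R -> cond_T tau step (stuttering_closure R).
Proof.
  intros HT s t a s' Hst Hstep.
  destruct (stuttering_closure_reach R HT s t Hst) as (n & Htn & Rsn).
  destruct (HT s n a s' Rsn Hstep) as (t'' & t' & Hn & Hopt & R1 & R2).
  exists t'', t'; repeat split; try assumption.
  - apply rt_trans with n; assumption.
  - apply stuttering_closure_incl; exact R1.
  - apply stuttering_closure_incl; exact R2.
Qed.

Lemma stuttering_closure_divergence_step R (u : nat -> State) :
  cond_T tau step R -> cond_D4 tau step R ->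
  (forall k, tau_step (u k) (u (S k))) ->
  forall x, (exists k, stuttering_closure R (u k) x) ->
  exists y, tau_step x y /\ exists k, stuttering_closure R (u k) y.
Proof.
  intros HT HD Hu x [k Hk].
  destruct (stuttering_closure_reach R HT _ _ Hk) as (n & Hxn & Rkn).
  destruct (tau_star_head _ _ Hxn) as [<-|(y & Hxy & Hyn)].
  2: { exists y; split; [exact Hxy|exists k].
       apply (stuttering_closure_between R (u k) x y n); try assumption.
       apply rt_step; exact Hxy. }
  destruct (classic (exists j, R (u j) x /\ ~ R (u (S j)) x))
    as [(j & Rj & Rj')|Hinv].
  - destruct (HT _ _ _ _ Rj (Hu j)) as (t'' & t' & Hxt & Hopt & R1 & R2).
    destruct (tau_star_head _ _ Hxt) as [<-|(y & Hxy & Hyt)].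
    (* An idle answer would leave [x] related to [u (S j)], against the choice of [j]. *)
    + destruct Hopt as [Hopt|[_ <-]]; [|contradiction].
      exists t'; split; [exact Hopt|exists (S j)].
      apply stuttering_closure_incl; exact R2.
    + exists y; split; [exact Hxy|exists j].
      apply (stuttering_closure_between R (u j) x y t''); try assumption.
      * apply stuttering_closure_incl; exact Rj.
      * apply rt_step; exact Hxy.
  - assert (Rall : forall i, R (u (i + k)) x).
    { induction i as [|i IH]; [exact Rkn|].
      apply NNPP; intro Hn; apply Hinv; exists (i + k); split; assumption. }
    (* (D4) is applied to the tail of [u] from index [k]; with the shift written [i + k], its start
       [0 + k] reduces to [k]. *)
    destruct (HD (u k) x (fun i => u (i + k)) Rkn eq_refl
                (fun i => conj (Hu (i + k)) (Rall i))) as (t' & Hxt & i & Ri).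
    destruct (tau_plus_head _ _ Hxt) as (y & Hxy & Hyt).
    exists y; split; [exact Hxy|exists (i + k)].
    apply (stuttering_closure_between R (u (i + k)) x y t'); try assumption.
    + apply stuttering_closure_incl, Rall.
    + apply rt_step; exact Hxy.
Qed.

Lemma stuttering_closure_D3 R :
  cond_T tau step R -> cond_D4 tau step R ->
  cond_D3 tau step (stuttering_closure R).
Proof.
  intros HT HD s t u Hst -> Hu.
  destruct (exists_infinite_path tau_step _
              (stuttering_closure_divergence_step R u HT HD Hu)
              t (ex_intro _ 0 Hst)) as (v & Hv0 & Hv).
  (* (D3) asks for no monotonicity of [sigma], so its values are chosen independently for each
     [l]. *)
  exists v, (fun l => proj1_sig
    (constructive_indefinite_description _ (proj2 (Hv l)))).
  split; [symmetry; exact Hv0|intro l; split; [exact (proj1 (Hv l))|]].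
  exact (proj2_sig (constructive_indefinite_description _ (proj2 (Hv l)))).
Qed.

End StutteringClosure.

Theorem theorem3 (A : Type) (tau : A) (State : Type)
    (step : State -> A -> State -> Prop) :
  inclusion State (simeq_D4 tau step) (simeq_D3 tau step).
Proof.
  intros s t (R & Rsym & HT & HD & Rst).
  exists (stuttering_closure tau step R); repeat split.
  - apply stuttering_closure_sym; exact Rsym.
  - apply stuttering_closure_T; exact HT.
  - apply stuttering_closure_D3; assumption.
  - apply stuttering_closure_incl; exact Rst.
Qed.
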